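(* Let $c^{(0)},c^{(1)}\in\mathbb{R}^n$, $b^{(0)},b^{(1)}\in\mathbb{R}^m$, $A^{(0)},A^{(1)}\in\mathbb{R}^{m\times n}$, and let $\theta(\varepsilon),\theta^*(\varepsilon),F^*(\varepsilon),J_0,\Theta_1,\theta_1,F_1^*$ be as defined in the context. Assume: (i) there exist $\gamma_0>0$ and a bounded set $B\subset\mathbb{R}^n$ such that $\theta^*(\varepsilon)\subset B$ for every $\varepsilon\in(0,\gamma_0]$; (ii) for all sufficiently small $\varepsilon>0$ the matrix $A^{(0)}+\varepsilon A^{(1)}$ has rank $m$. Then $$\limsup_{\varepsilon\downarrow0}\theta^*(\varepsilon)\subset\theta_1\qquad\text{and}\qquad \limsup_{\varepsilon\downarrow0}F^*(\varepsilon)\le F_1^*.$$ If, in addition, $A^{(0)}$ has rank $m$ and the extended Slater condition of order 1 holds, i.e. there exists $(\hat x^0,\hat x^1)\in\Theta_1$ such that $\hat x^1_j>0$ for every $j\notin J_0$ and $\hat x^0_j>0$ for every $j\in J_0$, then $$\limsup_{\varepsilon\downarrow0}\theta^*(\varepsilon)\subset\theta_1^*\qquad\text{and}\qquad \lim_{\varepsilon\downarrow0}F^*(\varepsilon)=F_1^*,$$ where $\theta_1^*$ is the set of optimal solutions of the problem $\max\{\langle c^{(0)},x^0\rangle : x^0\in\theta_1\}$. Also (under these additional assumptions), any optimal solution $x^0$ of the problem $\max\{\langle c^{(0)},x^0\rangle : x^0\in\theta_1\}$ is limiting optimal for the perturbed problem, i.e. $x^0\in\liminf_{\varepsilon\downarrow0}\theta(\varepsilon)$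 and $\lim_{\varepsilon\downarrow0}F^*(\varepsilon)=\langle c^{(0)},x^0\rangle$.
   Context: Perturbed linear program, with parameter $\varepsilon>0$ (the unperturbed problem is obtained by setting $\varepsilon=0$): $$\max\ \langle c^{(0)}+\varepsilon c^{(1)},x\rangle\quad\text{s.t.}\quad (A^{(0)}+\varepsilon A^{(1)})x=b^{(0)}+\varepsilon b^{(1)},\quad x\ge0 .$$ Its feasible set is $\theta(\varepsilon)=\{x\in\mathbb{R}^n: (A^{(0)}+\varepsilon A^{(1)})x=b^{(0)}+\varepsilon b^{(1)},\ x\ge0\}$, its set of optimal solutions is $\theta^*(\varepsilon)$, and its optimal value is $F^*(\varepsilon)$. In particular $\theta(0)=\{x\in\mathbb{R}^n: A^{(0)}x=b^{(0)},\ x\ge 0\}$. Define $$J_0=\{i\in\{1,\dots,n\}:\ \exists\,x\in\theta(0)\text{ such that }x_i>0\},$$ $$\Theta_1=\{(x^0,x^1)\in\mathbb{R}^n\times\mathbb{R}^n:\ x^0\in\theta(0),\ A^{(0)}x^1+A^{(1)}x^0=b^{(1)},\ x^1_j\ge0\ \ \forall j\notin J_0\},$$ $$\theta_1=\{x^0\in\mathbb{R}^n:\ \exists\,x^1\in\mathbb{R}^n \text{ with }(x^0,x^1)\in\Theta_1\},\qquad F_1^*=\max\{\langle c^{(0)},x^0\rangle: x^0\in\theta_1\}.$$ Set limits as $\varepsilon\downarrow0$ are in the Painlevé–Kuratowski sense: $\limsup_{\varepsilon\downarrow0}S(\varepsilon)$ is the set of all $x$ for which there exist $\varepsilon_k\downarrow0$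 and $x_k\in S(\varepsilon_k)$ with $x_k\to x$; $\liminf_{\varepsilon\downarrow0}S(\varepsilon)$ is the set of all $x$ for which there exist $x(\varepsilon)\in S(\varepsilon)$ for all sufficiently small $\varepsilon>0$ with $x(\varepsilon)\to x$ as $\varepsilon\downarrow0$.
   Formalization: The claims about F*(ε) (limsup F* ≤ F1*, lim F* = F1*, lim F* = ⟨c0,x0⟩) are proved assuming that F*(ε) < +∞ for all small ε > 0, since (i) holds vacuously for unbounded programs with empty θ*(ε), where these claims fail. *)

(* Defs.v *)
From HB Require Import structures.
From mathcomp Require Import all_boot all_order all_algebra.
From mathcomp Require Import all_classical all_reals all_analysis.
Import Order.TTheory GRing.Theory Num.Theory.
Import numFieldNormedType.Exports.

Set Implicit Arguments.
Unset Strict Implicit.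
Unset Printing Implicit Defensive.

Local Open Scope classical_set_scope.
Local Open Scope ring_scope.

Section LinearPrograms.
Context {R : realType} {m n : nat}.

Definition dot (c x : 'cV[R]_n) : R := \sum_(j < n) c j 0 * x j 0.

Definition lp_feasible (A : 'M[R]_(m, n)) (b : 'cV[R]_m) : set 'cV[R]_n :=
  [set x | A *m x = b /\ forall j, 0 <= x j 0].

Definition argmax_set (c : 'cV[R]_n) (S : set 'cV[R]_n) : set 'cV[R]_n :=
  [set x | S x /\ forall y, S y -> dot c y <= dot c x].

(* Optimal value in the extended reals: -oo if S is empty, +oo if the objective
   is unbounded above on S, and the maximum when it is attained. *)
Definition max_value (c : 'cV[R]_n) (S : set 'cV[R]_n) : \bar R :=
  ereal_sup [set (dot c x)%:E | x in S].

End LinearPrograms.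

Section SetLimits.
Context {R : realType} {n : nat}.
Implicit Type S : R -> set 'cV[R]_n.

(* Painleve-Kuratowski limits as the parameter decreases to 0. *)
Definition set_limsup S : set 'cV[R]_n :=
  [set x | exists (eps : nat -> R) (xs : nat -> 'cV[R]_n),
    [/\ forall k, 0 < eps k, eps k @[k --> \oo] --> (0 : R),
        forall k, S (eps k) (xs k) & xs k @[k --> \oo] --> x]].

Definition set_liminf S : set 'cV[R]_n :=
  [set x | exists xe : R -> 'cV[R]_n,
    (\forall e \near (0 : R)^'+, S e (xe e)) /\
    xe e @[e --> (0 : R)^'+] --> x].

End SetLimits.

Section PerturbedLP.
Context {R : realType} {m n : nat}.

Definition theta (b0 b1 : 'cV[R]_m) (A0 A1 : 'M[R]_(m, n)) (e : R) :
    set 'cV[R]_n :=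
  lp_feasible (A0 + e *: A1) (b0 + e *: b1).

Definition theta_star (c0 c1 : 'cV[R]_n)
    (b0 b1 : 'cV[R]_m) (A0 A1 : 'M[R]_(m, n)) (e : R) : set 'cV[R]_n :=
  argmax_set (c0 + e *: c1) (theta b0 b1 A0 A1 e).

Definition F_star (c0 c1 : 'cV[R]_n)
    (b0 b1 : 'cV[R]_m) (A0 A1 : 'M[R]_(m, n)) (e : R) : \bar R :=
  max_value (c0 + e *: c1) (theta b0 b1 A0 A1 e).

Definition J0 (b0 b1 : 'cV[R]_m) (A0 A1 : 'M[R]_(m, n)) : set 'I_n :=
  [set j | exists x, theta b0 b1 A0 A1 0 x /\ 0 < x j 0].

Definition Theta1 (b0 b1 : 'cV[R]_m) (A0 A1 : 'M[R]_(m, n)) :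
    set ('cV[R]_n * 'cV[R]_n) :=
  [set x | [/\ theta b0 b1 A0 A1 0 x.1,
               A0 *m x.2 + A1 *m x.1 = b1 &
               forall j, ~ J0 b0 b1 A0 A1 j -> 0 <= x.2 j 0]].

Definition theta1 (b0 b1 : 'cV[R]_m) (A0 A1 : 'M[R]_(m, n)) : set 'cV[R]_n :=
  [set x0 | exists x1, Theta1 b0 b1 A0 A1 (x0, x1)].

Definition theta1_star (c0 : 'cV[R]_n)
    (b0 b1 : 'cV[R]_m) (A0 A1 : 'M[R]_(m, n)) : set 'cV[R]_n :=
  argmax_set c0 (theta1 b0 b1 A0 A1).

Definition F1_star (c0 : 'cV[R]_n)
    (b0 b1 : 'cV[R]_m) (A0 A1 : 'M[R]_(m, n)) : \bar R :=
  max_value c0 (theta1 b0 b1 A0 A1).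

Definition extended_slater1 (b0 b1 : 'cV[R]_m) (A0 A1 : 'M[R]_(m, n)) : Prop :=
  exists x, [/\ Theta1 b0 b1 A0 A1 x,
    forall j, ~ J0 b0 b1 A0 A1 j -> 0 < x.2 j 0 &
    forall j, J0 b0 b1 A0 A1 j -> 0 < x.1 j 0].

(* The perturbed programs are eventually not unbounded above, i.e. F_star has a
   genuine meaning as a maximum wherever the program is feasible.  A program
   that is unbounded above has an empty theta_star, so boundedness of
   theta_star does not exclude this. *)
Definition eventually_bounded_above (c0 c1 : 'cV[R]_n)
    (b0 b1 : 'cV[R]_m) (A0 A1 : 'M[R]_(m, n)) : Prop :=
  \forall e \near (0 : R)^'+, (F_star c0 c1 b0 b1 A0 A1 e < +oo)%E.

End PerturbedLP.

(* Main.v *)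
Require Import Defs.
From HB Require Import structures.
From mathcomp Require Import all_boot all_order all_algebra.
From mathcomp Require Import all_classical all_reals all_analysis.
From mathcomp Require Import ring lra.
Import Order.TTheory GRing.Theory Num.Theory.
Import numFieldNormedType.Exports.
Local Open Scope classical_set_scope.
Local Open Scope ring_scope.

(** The theorem rests on two facts about the limit [e -> 0].

    First, every limit [x0] of feasible points of the perturbed programs is in
    [theta1] ([limit_theta1]).  Writing a feasible point as [x0 + e y], the
    perturbed equation reads [A0 y = b1 - A1 (x0 + e y)], and [y] is nonnegative
    at the indices outside [J0], where [x0] vanishes.  So [b1 - A1 x0] is a limit
    of points of the cone of all such [A0 y].  That cone is finitely generated,
    hence closed, by the Farkas lemma ([farkas], [farkas_signed]), and the
    first-order term [x1] exists even when the vectors [y] diverge.  This gives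
    the first inclusion.  For the optimal values, the Farkas lemma also shows
    that a feasible linear program which is bounded above has an optimal
    solution ([lp_attained]); these solutions stay in the bounded set, so they
    accumulate at a point of [theta1], and no value above [F1_star] can be
    approached ([F_star_near_lt]).

    Second, under the rank and Slater conditions every point [x0] of [theta1] is
    a limit of feasible points, one for each small [e] ([slater_restoration],
    [theta1_sub_liminf]).  The point [x0 + e x1] violates the perturbed equation
    by [O(e^2)] only, which a right inverse of [A0 + e A1], bounded
    uniformly in [e] ([uniform_right_inverse]), corrects by [O(e^2)].  The
    correction could spoil the signs; moving beforehand a distance [K e] towards
    the Slater point, with [K] large, leaves enough room.  Feasible points near
    [x0] bound the optimal values from below ([F_star_near_gt]), which together
    with the upper bound yields the limit of [F_star]; comparing them with
    optimal solutions shows that limits of the latter maximise [dot c0] over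
    [theta1] ([limsup_sub_argmax]). *)

(** * Alternatives for systems of linear inequalities *)

(** Induction on the columns.  If the remaining columns [N] alone do not
    generate [z], some [w0] separates them from [z]; since [w0] cannot separate
    [z] from the full cone, it is negative on the first column [a].
    Project along [a] onto the hyperplane orthogonal to [w0]: a functional
    composed with this projection vanishes on [a], so it cannot separate the
    projected [z] from the projected columns, and the induction hypothesis
    applies.  Undoing the projection only adds a multiple of [a], whose
    coefficient has the right sign because [w0] is nonnegative on [N] and
    negative on [a] and on [z]. *)
Lemma farkas {R : realFieldType} {m n : nat} (M : 'M[R]_(m, n)) (z : 'cV[R]_m) :
  (forall w : 'rV[R]_m,
     (forall j, 0 <= (w *m M) 0 j) -> 0 <= (w *m z) 0 0) ->
  exists2 x : 'cV[R]_n, (forall j, 0 <= x j 0) & M *m x = z.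
Proof.
elim: n M z => [|n IH] M z Mz.
  exists 0 => [[]//|]; rewrite mulmx0; apply/esym/colP => i.
  have z_ge0 (w : 'rV[R]_m) : 0 <= (w *m z) 0 0 by apply: Mz => -[].
  have := z_ge0 (delta_mx 0 i); have := z_ge0 (- delta_mx 0 i).
  by rewrite mulNmx -rowE !mxE; lra.
pose a := lsubmx (M : 'M[R]_(m, 1 + n)); pose N := rsubmx (M : 'M[R]_(m, 1 + n)).
have ME : M = row_mx a N :> 'M[R]_(m, 1 + n) by rewrite hsubmxK.
have coneE (t : R) (x : 'cV[R]_n) : 0 <= t -> (forall j, 0 <= x j 0) ->
    t *: a + N *m x = z ->
    exists2 x : 'cV[R]_n.+1, (forall j, 0 <= x j 0) & M *m x = z.
  move=> t_ge0 x_ge0 <-; exists (col_mx t%:M x : 'cV[R]_(1 + n)).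
    move=> j; have [k ->|k ->] := split_ordP (j : 'I_(1 + n)).
      by rewrite (col_mxEu (t%:M : 'M[R]_1) x k) ord1 mxE eqxx mulr1n.
    by rewrite (col_mxEd (t%:M : 'M[R]_1) x k).
  by rewrite ME (mul_row_col a N) mul_mx_scalar.
have geM (w : 'rV[R]_m) : 0 <= (w *m a) 0 0 -> (forall j, 0 <= (w *m N) 0 j) ->
    0 <= (w *m z) 0 0.
  move=> wa wN; apply: Mz => j; rewrite ME (mul_mx_row w a N).
  have [k ->|k ->] := split_ordP (j : 'I_(1 + n)); last first.
    by rewrite (row_mxEr (w *m a) (w *m N) 0 k).
  by rewrite (row_mxEl (w *m a) (w *m N) 0 k) ord1.
have [/IH[x x_ge0 Nx]|/existsNP[w0 /not_implyP[w0N /negP]]] :=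
    pselect (forall w : 'rV[R]_m, (forall j, 0 <= (w *m N) 0 j) -> 0 <= (w *m z) 0 0).
  by apply: (coneE 0 x) => //; rewrite scale0r add0r.
rewrite -ltNge => w0z.
pose al : R := (w0 *m a) 0 0.
have al_lt0 : al < 0.
  by rewrite ltNge; apply/negP => /geM /(_ w0N); rewrite leNgt w0z.
(* [P] is the projection along [a] onto the hyperplane where [w0] vanishes. *)
pose P := 1%:M - al^-1 *: (a *m w0).
have wPE (w : 'rV[R]_m) : w *m P = w - ((w *m a) 0 0 / al) *: w0.
  rewrite mulmxBr mulmx1 -scalemxAr mulmxA [w *m a]mx11_scalar mul_scalar_mx.
  by rewrite scalerA mulrC !mxE eqxx mulr1n.
have wPa (w : 'rV[R]_m) : w *m P *m a = 0.
  rewrite wPE mulmxBl -scalemxAl [in X in X - _](mx11_scalar (w *m a)).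
  by rewrite (mx11_scalar (w0 *m a)) scale_scalar_mx divfK ?lt_eqF ?subrr.
have [|x x_ge0 PNx] := IH (P *m N) (P *m z).
  move=> w wPN; rewrite mulmxA; apply: geM; first by rewrite wPa mxE.
  by move=> j; rewrite -mulmxA.
pose t := ((w0 *m z) 0 0 - (w0 *m (N *m x)) 0 0) / al.
have NxE : t *: a + N *m x = z.
  have : N *m x - al^-1 *: (a *m (w0 *m (N *m x))) =
         z - al^-1 *: (a *m (w0 *m z)).
    move: PNx; rewrite -(mulmxA P) /P !mulmxBl !mul1mx -!scalemxAl.
    by rewrite -!(mulmxA a).
  rewrite [w0 *m z]mx11_scalar [w0 *m (N *m x)]mx11_scalar.
  rewrite !mul_mx_scalar !scalerA => /eqP; rewrite subr_eq => /eqP ->.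
  rewrite addrC -!addrA -scaleNr -!scalerDl -[RHS]addr0 -(scale0r a) /t.
  by congr (_ + _ *: _); ring.
apply: (coneE t x) => //; rewrite /t.
rewrite -mulrNN -invrN divr_ge0 ?oppr_ge0 ?(ltW al_lt0) // subr_le0.
rewrite (le_trans (ltW w0z)) // mulmxA mxE sumr_ge0 // => j _.
by rewrite mulr_ge0.
Qed.

(** A free coordinate, that is, one outside [P], is a difference of two
    nonnegative ones: its column is entered a second time with the opposite
    sign, by means of the diagonal matrix [D]. *)
Lemma farkas_signed {R : realFieldType} {m n : nat} (P : pred 'I_n)
    (M : 'M[R]_(m, n)) (z : 'cV[R]_m) :
  (forall w : 'rV[R]_m, (forall j, P j -> 0 <= (w *m M) 0 j) ->
     (forall j, ~~ P j -> (w *m M) 0 j = 0) -> 0 <= (w *m z) 0 0) ->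
  exists2 x : 'cV[R]_n, (forall j, P j -> 0 <= x j 0) & M *m x = z.
Proof.
move=> Mz; pose D : 'M[R]_n := diag_mx (\row_j (if P j then 0 else - 1)).
have [|x x_ge0 <-] := farkas (row_mx M (M *m D)) z.
  move=> w; rewrite mul_mx_row mulmxA => wMD.
  have wM j : 0 <= (w *m M) 0 j.
    by have := wMD (lshift n j); rewrite row_mxEl.
  have wD j : ~~ P j -> (w *m M) 0 j <= 0.
    move=> /negPf Pj; have := wMD (rshift n j).
    by rewrite row_mxEr mul_mx_diag !mxE Pj mulrN1 oppr_ge0.
  apply: Mz => j Pj //; apply/eqP; rewrite eq_le wM andbT; exact: wD.
exists (usubmx x + D *m dsubmx x) => [j Pj|].
  by rewrite mul_diag_mx !mxE Pj mul0r addr0 x_ge0.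
by rewrite -{3}[x]vsubmxK mul_row_col mulmxDr mulmxA.
Qed.

Lemma dotE {R : realType} {n : nat} (c x : 'cV[R]_n) :
  dot c x = (c^T *m x) 0 0.
Proof. by rewrite mxE; apply: eq_bigr => j _; rewrite mxE. Qed.

(** A finite supremum [s] is a maximum as soon as [(b, s)] lies in the cone
    generated by the columns of [A] stacked over [c^T].  By [farkas] this is
    checked on functionals [(u, t)]; nonnegativity at [(b, dot c x)] for the
    feasible [x] passes to the supremum, differently according to the sign
    of [t]. *)
Lemma lp_attained {R : realType} {m n : nat} (A : 'M[R]_(m, n)) b (c : 'cV[R]_n) :
  lp_feasible A b !=set0 -> (max_value c (lp_feasible A b) < +oo)%E ->
  exists2 x, argmax_set c (lp_feasible A b) x &
    max_value c (lp_feasible A b) = (dot c x)%:E.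
Proof.
move=> [y Fy] ltoo.
have dot_le x : lp_feasible A b x ->
    ((dot c x)%:E <= max_value c (lp_feasible A b))%E.
  by move=> Fx; apply: ereal_sup_ubound; exists x.
case sE : (max_value c (lp_feasible A b)) => [s||]; last 2 first.
- by rewrite sE in ltoo.
- by have := dot_le _ Fy; rewrite sE.
have sup_le r : (forall x, lp_feasible A b x -> dot c x <= r) -> s <= r.
  move=> rP; rewrite -lee_fin -sE; apply: ge_ereal_sup => _ [x Fx <-].
  by rewrite lee_fin rP.
have [|x x_ge0] := farkas (col_mx A c^T) (col_mx b s%:M).
  move=> w; rewrite -[w]hsubmxK; set u := lsubmx w; set t := (rsubmx w) 0 0.
  rewrite [rsubmx w]mx11_scalar -/t !mul_row_col !mul_scalar_mx => wM.
  rewrite mxE [X in _ + X]mxE [X in _ * X]mxE eqxx mulr1n.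
  set ub := (u *m b) 0 0.
  have main x : lp_feasible A b x -> 0 <= ub + t * dot c x.
    move=> [Ax xge0].
    have : 0 <= ((u *m A + t *: c^T) *m x) 0 0.
      by rewrite mxE sumr_ge0 // => j _; rewrite mulr_ge0.
    rewrite mulmxDl -mulmxA Ax -scalemxAl mxE.
    by rewrite [X in _ + X]mxE -dotE.
  have [t_ge0|t_lt0] := leP 0 t.
    rewrite (le_trans (main y Fy)) // lerD2l ler_wpM2l //.
    by rewrite -lee_fin -sE dot_le.
  have : s <= ub / (- t).
    by apply: sup_le => x /main; rewrite ler_pdivlMr ?oppr_gt0 //; nra.
  by rewrite ler_pdivlMr ?oppr_gt0 //; nra.
rewrite mul_col_mx => /eq_col_mx[Ax cx].
have dx : dot c x = s by rewrite dotE cx mxE eqxx mulr1n.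
exists x; last by rewrite dx.
by split => // x' Fx'; rewrite dx -lee_fin -sE dot_le.
Qed.

Lemma le_coord_norm {K : realFieldType} {m n : nat} (M : 'M[K]_(m, n)) i j :
  `|M i j| <= `|M|.
Proof.
by rewrite [leRHS]/Num.norm /= mx_normrE; apply: (le_bigmax _ _ (i, j)).
Qed.

Lemma mx_norm_le {K : realFieldType} {m n : nat} (M : 'M[K]_(m, n)) (r : K) :
  0 <= r -> (forall i j, `|M i j| <= r) -> `|M| <= r.
Proof.
move=> r_ge0 Mr; rewrite [leLHS]/Num.norm /= mx_normrE.
by apply: bigmax_le => // -[i j] _; exact: Mr.
Qed.

Lemma mulmx_norm_le {K : realFieldType} {m n p : nat} (M : 'M[K]_(m, n))
    (N : 'M[K]_(n, p)) :
  `|M *m N| <= n%:R * `|M| * `|N|.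
Proof.
apply: mx_norm_le => [|i k]; first by rewrite !mulr_ge0.
rewrite mxE (le_trans (ler_norm_sum _ _ _)) //.
have -> : n%:R * `|M| * `|N| = \sum_(j < n) `|M| * `|N|.
  by rewrite sumr_const card_ord -mulrA mulr_natl.
by apply: ler_sum => j _; rewrite normrM ler_pM // le_coord_norm.
Qed.

(** * Convergence of matrices *)

Lemma cvg_mxP {K : numFieldType} {T : Type} {F : set_system T} {FF : Filter F}
    {m n : nat} (X : T -> 'M[K]_(m, n)) (x : 'M[K]_(m, n)) :
  X @ F --> x <-> (forall i j, X t i j @[t --> F] --> x i j).
Proof.
split=> [Xx i j|Xx].
  apply: (@continuous_cvg _ _ _ F FF X (fun M => M i j) x) => //.
  exact: coord_continuous.
move=> A [B nB sB]; apply: (@filterS _ F _ (fun t => forall i j, B i j (X t i j))).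
  by move=> t Bt; apply: sB.
by apply: filter_forall => i; apply: filter_forall => j; apply: Xx; exact: nB.
Qed.

Lemma cvg_mulmx {K : numFieldType} {T : Type} {F : set_system T} {FF : Filter F}
    {m n p : nat} (X : T -> 'M[K]_(m, n)) (Y : T -> 'M[K]_(n, p))
    (x : 'M[K]_(m, n)) (y : 'M[K]_(n, p)) :
  X @ F --> x -> Y @ F --> y -> X t *m Y t @[t --> F] --> x *m y.
Proof.
move=> /cvg_mxP Xx /cvg_mxP Yy; apply/cvg_mxP => i k.
under eq_fun do rewrite mxE; rewrite mxE.
by apply: cvg_big => [|j _]; [exact: add_continuous|apply: cvgM].
Qed.

Lemma cvg_affine {K : numFieldType} {V : normedModType K} {T : Type}
    {F : set_system T} {FF : Filter F} (eps : T -> K) (a b : V) :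
  eps @ F --> (0 : K) -> a + eps t *: b @[t --> F] --> a.
Proof.
move=> eps0; rewrite -[X in _ --> X]addr0 -(scale0r b).
by apply: cvgD; [exact: cvg_cst | exact: cvgZr_tmp].
Qed.

Lemma cvg_dot {R : realType} {n : nat} {T : Type} {F : set_system T}
    {FF : Filter F} (c x : T -> 'cV[R]_n) (c' x' : 'cV[R]_n) :
  c @ F --> c' -> x @ F --> x' -> dot (c t) (x t) @[t --> F] --> dot c' x'.
Proof.
move=> /cvg_mxP cc /cvg_mxP xx.
by apply: cvg_big => [|j _]; [exact: add_continuous|apply: cvgM].
Qed.

Lemma ultra_fmap {T U : Type} (f : T -> U) (F : set_system T) :
  UltraFilter F -> UltraFilter (f @ F).
Proof.
move=> FU; split; first exact: fmap_proper_filter.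
move=> G GP FG; apply/seteqP; split=> // A GA.
have [//|FnA] := in_ultra_setVsetC (f @^-1` A) FU.
have : G (A `&` ~` A) by apply: filterI => //; exact: FG.
by rewrite setICr => /(@filter_not_empty _ _ GP).
Qed.

(** Bolzano-Weierstrass in filter form: refining a filter to an ultrafilter
    replaces the extraction of a convergent subsequence, and lets the
    coordinates be treated one at a time. *)
Lemma ultra_bounded_cvg {R : realType} {T : Type} {m n : nat}
    (F : set_system T) (X : T -> 'M[R]_(m, n)) (K : R) :
  UltraFilter F -> (\forall t \near F, `|X t| <= K) ->
  exists x : 'M[R]_(m, n), X @ F --> x.
Proof.
move=> FU XK.
have cvgX i j : exists l : R, X t i j @[t --> F] --> l.
  have : compact `[- K, K] by exact: segment_compact.
  rewrite compact_ultra => /(_ (X t i j @[t --> F])) [].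
  - exact: ultra_fmap.
  - apply: filterS XK => t; rewrite /= in_itv /= -ler_norml; apply: le_trans.
    exact: le_coord_norm.
  - by move=> l [_ lX]; exists l.
exists (\matrix_(i, j) sval (cid (cvgX i j))); apply/cvg_mxP => i j.
by rewrite mxE; apply: (svalP (cid (cvgX i j))).
Qed.

(** * Limits of feasible points *)

Section Perturbed.
Context {R : realType} {m n : nat}.
Variables (b0 b1 : 'cV[R]_m) (A0 A1 : 'M[R]_(m, n)).

Lemma theta_notJ0 x j : theta b0 b1 A0 A1 0 x -> ~ J0 b0 b1 A0 A1 j -> x j 0 = 0.
Proof.
move=> tx nJ; apply/eqP; rewrite eq_le tx.2 andbT leNgt.
by apply/negP => xj; apply: nJ; exists x.
Qed.

(** The quotients [(xs t - x0) / eps t] satisfy all the constraints required of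
    the first-order term [x1], up to the error [A1 (xs t - x0)], but they may
    diverge.  What survives in the limit is that [b1 - A1 x0] is a limit of
    points of the cone [{A0 y | y_j >= 0 for j outside J0}]; a finitely generated
    cone is closed, which is what [farkas_signed] provides. *)
Lemma limit_theta1 {T : Type} {F : set_system T} {FF : ProperFilter F}
    (eps : T -> R) (xs : T -> 'cV[R]_n) (x0 : 'cV[R]_n) :
  (\forall t \near F, 0 < eps t) -> eps @ F --> (0 : R) ->
  (\forall t \near F, theta b0 b1 A0 A1 (eps t) (xs t)) -> xs @ F --> x0 ->
  theta1 b0 b1 A0 A1 x0.
Proof.
move=> eps_gt0 eps0 xsF xsx0.
have tx0 : theta b0 b1 A0 A1 0 x0.
  split=> [|j].
    rewrite !scale0r !addr0.
    have xs1 : (A0 + eps t *: A1) *m xs t @[t --> F] --> A0 *m x0.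
      by apply: cvg_mulmx => //; exact: cvg_affine.
    have xs2 : (A0 + eps t *: A1) *m xs t @[t --> F] --> b0.
      have : b0 + eps t *: b1 @[t --> F] --> b0 by exact: cvg_affine.
      apply: cvg_trans; apply: near_eq_cvg.
      by apply: filterS xsF => t [].
    by apply: cvg_unique xs1 xs2.
  have /cvg_mxP/(_ j 0) xsj := xsx0.
  apply: (cvgr_to_ge xsj).
  by apply: filterS xsF => t [_ /(_ j)].
have [|x1 x1_ge0 A0x1] := farkas_signed (fun j => ~~ `[< J0 b0 b1 A0 A1 j >])
    A0 (b1 - A1 *m x0).
  move=> w wN wJ.
  have lim : (w *m (b1 - A1 *m xs t)) 0 0 @[t --> F] -->
      (w *m (b1 - A1 *m x0)) 0 0.
    have : w *m (b1 - A1 *m xs t) @[t --> F] --> w *m (b1 - A1 *m x0).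
      apply: cvg_mulmx; first exact: cvg_cst.
      by apply: cvgB; [exact: cvg_cst|apply: cvg_mulmx => //; exact: cvg_cst].
    by move/cvg_mxP.
  apply: (cvgr_to_ge lim).
  near=> t.
  have et : 0 < eps t by near: t.
  have [At xt] : theta b0 b1 A0 A1 (eps t) (xs t) by near: t.
  have -> : b1 - A1 *m xs t = (eps t)^-1 *: (A0 *m (xs t - x0)).
    apply: (scalerI (lt0r_neq0 et)); rewrite scalerA divff ?lt0r_neq0 // scale1r.
    have [A0x0 _] := tx0; rewrite !scale0r !addr0 in A0x0.
    have A0xt : A0 *m xs t = b0 + eps t *: b1 - eps t *: (A1 *m xs t).
      by rewrite -At mulmxDl -scalemxAl addrK.
    by rewrite mulmxBr A0x0 A0xt scalerBr addrAC [b0 + _]addrC addrK.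
  rewrite -scalemxAr mxE mulr_ge0 ?invr_ge0 ?(ltW et) // mulmxA mxE.
  rewrite sumr_ge0 // => j _; have [Jj|nJj] := pselect (J0 b0 b1 A0 A1 j).
    by rewrite wJ ?mul0r // negbK; apply/asboolP.
  rewrite mulr_ge0 ?wN //; first by apply/asboolPn.
  by rewrite !mxE (theta_notJ0 _ _ tx0 nJj) // subr0.
exists x1; split => //=; first by rewrite A0x1 subrK.
by move=> j nJ; apply: x1_ge0; apply/asboolPn.
Unshelve. all: by end_near. Qed.

End Perturbed.

(** * The upper bound on the optimal values *)

(** If the conclusion failed, the values of [e] with [F_star e >= r] would
    accumulate at [0]. Along an ultrafilter of such [e] the optimal
    solutions exist, stay in [B] and converge to some point of [theta1] where
    [dot c0] is at least [r], which contradicts the bound on [F1_star]. *)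
Lemma F_star_near_lt {R : realType} {m n : nat}
    (c0 c1 : 'cV[R]_n) (b0 b1 : 'cV[R]_m) (A0 A1 : 'M[R]_(m, n))
    (gamma : R) (B : set 'cV[R]_n) (r : R) :
  0 < gamma -> bounded_set B ->
  (forall e : R, 0 < e <= gamma -> theta_star c0 c1 b0 b1 A0 A1 e `<=` B) ->
  eventually_bounded_above c0 c1 b0 b1 A0 A1 ->
  (F1_star c0 b0 b1 A0 A1 < r%:E)%E ->
  \forall e \near (0 : R)^'+, (F_star c0 c1 b0 b1 A0 A1 e < r%:E)%E.
Proof.
move=> gamma_gt0 Bbd tB bdd F1r; apply: contrapT => notlt.
pose D : set R := [set e | (r%:E <= F_star c0 c1 b0 b1 A0 A1 e)%E].
have wP : ProperFilter (within D (0 : R)^'+).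
  split; last exact: within_filter.
  move=> w0; apply: notlt; near=> e.
  have nD : ~ D e by near: e.
  by rewrite ltNge; apply/negP.
have [U [UU wU]] := ultraFilterLemma wP.
have UD : U D by apply: wU; apply: withinT.
have nearU (P : set R) : (\forall e \near (0 : R)^'+, P e) -> U P.
  by move=> P0; apply: wU; exact: (filterS (fun e Pe _ => Pe) P0).
pose xs e := xget 0 (theta_star c0 c1 b0 b1 A0 A1 e).
have U_xs : \forall e \near U, theta_star c0 c1 b0 b1 A0 A1 e (xs e) /\
    r <= dot (c0 + e *: c1) (xs e).
  apply: filterS2 UD (nearU _ bdd) => e De Fe.
  have ne : theta b0 b1 A0 A1 e !=set0.
    apply/set0P/negP => /eqP t0; move: De.
    by rewrite /D /= /F_star /max_value t0 image_set0 ereal_sup0.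
  have [x x_opt Fx] := lp_attained _ _ _ ne Fe.
  have xse : theta_star c0 c1 b0 b1 A0 A1 e (xs e) by apply: (xgetPex 0); exists x.
  split=> //; rewrite -lee_fin; apply: (le_trans De).
  by rewrite /F_star Fx lee_fin; apply: xse.2; case: x_opt.
have e_gt0 : U [set e | 0 < e] by apply: nearU; exact: nbhs_right_gt.
have [K K_gt0 BK] := ex_strict_bound_gt0 Bbd.
have [x xsx] : exists x : 'cV[R]_n, xs @ U --> x.
  apply: (ultra_bounded_cvg U xs K UU).
  have eg : U [set e | e <= gamma] by apply: nearU; exact: nbhs_right_le.
  apply: filterS2 U_xs (filterI e_gt0 eg) => e [xse _] [eg0 eg1].
  by apply/ltW/BK/(tB e) => //; apply/andP; split.
have U0 : id @ U --> (0 : R).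
  move=> P P0; apply: nearU.
  by apply: (cvg_at_right_filter (f := id)) P0; exact: cvg_id.
have t1x : theta1 b0 b1 A0 A1 x.
  apply: (limit_theta1 _ _ _ _ id xs x e_gt0 U0 _ xsx).
  by apply: filterS U_xs => e [[]].
have : (r <= dot c0 x).
  have lim : dot (c0 + e *: c1) (xs e) @[e --> U] --> dot c0 x.
    by apply: cvg_dot => //; apply: (cvg_affine id).
  by apply: (cvgr_to_ge lim); apply: filterS U_xs => e [].
rewrite leNgt -lte_fin (le_lt_trans _ F1r) //.
by apply: ereal_sup_ubound; exists x.
Unshelve. all: by end_near. Qed.

(** * Feasible points near a point of [theta1] *)

(** If [P] is a right inverse of [A0], then [(A0 + e A1) P = 1 + e A1 P] is a
    small perturbation of the identity, so it is invertible and its inverse at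
    most doubles the norm. *)
Lemma uniform_right_inverse {R : realType} {m n : nat} (A0 A1 : 'M[R]_(m, n)) :
  \rank A0 = m ->
  exists C d : R, [/\ 0 <= C, 0 < d & forall e : R, 0 < e <= d ->
    forall r : 'cV[R]_m, exists2 x : 'cV[R]_n,
      (A0 + e *: A1) *m x = r & `|x| <= C * `|r|].
Proof.
move=> rk; have A0free : row_free A0 by rewrite /row_free rk.
pose P := pinvmx A0; have A0P : A0 *m P = 1%:M by exact: mulmxVp.
pose Q := A1 *m P; pose q : R := 1 + m%:R * `|Q|.
have q_gt0 : 0 < q by rewrite ltr_pwDl // mulr_ge0.
exists (m%:R * `|P| * 2), (2 * q)^-1; split.
- by rewrite !mulr_ge0.
- by rewrite invr_gt0 mulr_gt0.
move=> e /andP[e_gt0 e_le] r.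
have eq_half : e * q <= 2^-1.
  by rewrite -ler_pdivlMr // -invfM.
have smallr (v : 'cV[R]_m) : `|v| <= 2 * `|(1%:M + e *: Q) *m v|.
  have le1 : `|e *: Q *m v| <= 2^-1 * `|v|.
    rewrite -scalemxAl normrZ gtr0_norm //.
    apply: (@le_trans _ _ (e * q * `|v|)); last by rewrite ler_wpM2r.
    rewrite -mulrA ler_pM2l // (le_trans (mulmx_norm_le _ _)) // ler_wpM2r //.
    by rewrite lerDr.
  have : `|v| <= `|(1%:M + e *: Q) *m v| + `|e *: Q *m v|.
    rewrite -{1}[v](addrK (e *: Q *m v)) (le_trans (ler_normB _ _)) // lerD2r.
    by rewrite mulmxDl mul1mx.
  lra.
have unit : 1%:M + e *: Q \in unitmx.
  rewrite -unitmx_tr -row_free_unit -kermx_eq0; apply/rowV0P => v.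
  move=> /sub_kermxP /(congr1 trmx); rewrite trmx_mul trmxK trmx0 => v0.
  apply/trmx_inj/eqP; rewrite trmx0 -normr_le0.
  by have := smallr v^T; rewrite v0 normr0 mulr0.
exists (P *m (invmx (1%:M + e *: Q) *m r)).
  rewrite mulmxA mulmxDl A0P -scalemxAl -/Q mulmxA mulmxV //; exact: mul1mx.
set u := invmx _ *m r.
have ur : `|u| <= 2 * `|r|.
  by rewrite (le_trans (smallr u)) // mulmxA mulmxV // mul1mx.
rewrite (le_trans (mulmx_norm_le _ _)) //.
by rewrite -[leRHS]mulrA ler_wpM2l // mulr_ge0.
Qed.

(** Take [(x0, x1)] and the Slater pair [(z0, z1)] in [Theta1], and move a
    fraction [K e] of the way from the former to the latter, reaching
    [(p0, p1)].  The point [p0 + e p1] satisfies the perturbed equation up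
    to [e^2 A1 p1], which a correction [y] of size [H e^2] repairs.
    Signs survive when [K] is large: on [J0] the margin [K e z0_j] beats
    the loss [e N + H e^2], and off [J0] the margin [K e^2 z1_j] beats
    the loss [H e^2]. *)
Lemma slater_restoration {R : realType} {m n : nat}
    (b0 b1 : 'cV[R]_m) (A0 A1 : 'M[R]_(m, n)) (x0 : 'cV[R]_n) :
  \rank A0 = m -> extended_slater1 b0 b1 A0 A1 -> theta1 b0 b1 A0 A1 x0 ->
  exists L d : R, 0 < d /\ forall e : R, 0 < e <= d ->
    exists2 x, theta b0 b1 A0 A1 e x & `|x - x0| <= L * e.
Proof.
move=> rk [[z0 z1] /= [[/= tz Az z1_ge0] z1_gt0 z0_gt0]] [x1 [/= tx Ax x1_ge0]].
have [C [d [C_ge0 d_gt0 restore]]] := uniform_right_inverse A0 A1 rk.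
pose N : R := `|x1| + `|z1 - x1|.
pose H : R := C * (n%:R * `|A1| * N).
have N_ge0 : 0 <= N by rewrite addr_ge0.
have H_ge0 : 0 <= H by rewrite !mulr_ge0.
(* [s j] is the positive slack that the Slater pair offers at coordinate [j]. *)
pose s j : R := if `[< J0 b0 b1 A0 A1 j >] then z0 j 0 else z1 j 0.
have s_gt0 j : 0 < s j.
  by rewrite /s; case: asboolP => [/z0_gt0|/z1_gt0].
pose K : R := 1 + \sum_j (N + H) / s j.
have term_ge0 j : 0 <= (N + H) / s j by rewrite divr_ge0 ?addr_ge0 // ltW.
have K_gt0 : 0 < K by rewrite ltr_pwDl // sumr_ge0.
have Ks j : N + H <= K * s j.
  rewrite -ler_pdivrMr // /K (bigD1 j) //= addrCA lerDl addr_ge0 //.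
  by rewrite sumr_ge0.
exists (K * `|z0 - x0| + N + H), (Num.min d (Num.min 1 K^-1)); split.
  by rewrite !lt_min d_gt0 ltr01 invr_gt0.
move=> e /andP[e_gt0]; rewrite !le_min => /and3P[ed e1 eK].
have Ke1 : K * e <= 1 by rewrite mulrC -ler_pdivlMr // mul1r.
have Ke_ge0 : 0 <= K * e by rewrite mulr_ge0 ?ltW.
pose p0 := x0 + (K * e) *: (z0 - x0); pose p1 := x1 + (K * e) *: (z1 - x1).
have p1N : `|p1| <= N.
  rewrite (le_trans (ler_normD _ _)) // lerD2l normrZ ger0_norm //.
  by rewrite ler_piMl.
have [|y Ay yC] := restore e _ (e ^+ 2 *: (A1 *m p1)); first by rewrite e_gt0.
have yH : `|y| <= H * e ^+ 2.
  rewrite (le_trans yC) // normrZ ger0_norm ?exprn_ge0 ?(ltW e_gt0) //.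
  rewrite /H -mulrA ler_wpM2l // mulrC ler_wpM2r ?exprn_ge0 ?(ltW e_gt0) //.
  by rewrite (le_trans (mulmx_norm_le _ _)) // ler_wpM2l // mulr_ge0.
have Ap0 : A0 *m p0 = b0.
  have [A0x _] := tx; have [A0z _] := tz.
  rewrite !scale0r !addr0 in A0x A0z.
  by rewrite mulmxDr -scalemxAr mulmxBr A0x A0z subrr scaler0 addr0.
have Ap1 : A0 *m p1 + A1 *m p0 = b1.
  rewrite !mulmxDr -!scalemxAr addrACA -scalerDr !mulmxBr Ax.
  by rewrite addrACA -opprD Az Ax subrr scaler0 addr0.
have expand (p q : 'cV[R]_n) : A0 *m p = b0 -> A0 *m q + A1 *m p = b1 ->
    (A0 + e *: A1) *m (p + e *: q) =
      b0 + e *: b1 + e ^+ 2 *: (A1 *m q).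
  move=> Ap <-; rewrite mulmxDl !mulmxDr Ap -!scalemxAl -!scalemxAr.
  by rewrite scalerA -expr2 scalerDr !addrA.
have coordN (v : 'cV[R]_n) r j : `|v| <= r -> - r <= v j 0 /\ v j 0 <= r.
  by move=> vr; apply/andP; rewrite -ler_norml (le_trans (le_coord_norm _ _ _)).
exists (p0 + e *: p1 - y); first split.
- by rewrite mulmxBr Ay expand // addrK.
- move=> j; have [_ yj] := coordN _ _ j yH.
  have := Ks j; have := s_gt0 j; rewrite /s; case: asboolP => [Jj|nJj] sj Ksj.
  + have [p1j _] := coordN _ _ j p1N.
    have x0j := tx.2 j.
    have -> : (p0 + e *: p1 - y) j 0 =
        x0 j 0 + K * e * (z0 j 0 - x0 j 0) + e * p1 j 0 - y j 0 by rewrite !mxE.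
    have : K * e * x0 j 0 <= x0 j 0 by rewrite ler_piMl.
    have : e * (N + H) <= e * (K * z0 j 0) by rewrite ler_pM2l.
    have : e * - N <= e * p1 j 0 by rewrite ler_pM2l.
    have : H * e ^+ 2 <= H * e by rewrite ler_wpM2l // expr2 ler_piMr // ltW.
    lra.
  + have x1j := x1_ge0 j nJj.
    rewrite !mxE (theta_notJ0 _ _ _ _ _ _ tx nJj) (theta_notJ0 _ _ _ _ _ _ tz nJj).
    have : e * (K * e * x1 j 0) <= e * x1 j 0.
      by rewrite ler_pM2l // ler_piMl.
    have : e ^+ 2 * (N + H) <= e ^+ 2 * (K * z1 j 0).
      by rewrite ler_pM2l // exprn_gt0.
    have : 0 <= e ^+ 2 * N by rewrite mulr_ge0 // exprn_ge0 // ltW.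
    lra.
clearbody K N.
have -> : p0 + e *: p1 - y - x0 = (K * e) *: (z0 - x0) + e *: p1 - y.
  by rewrite /p0 -!addrA addrC !addrA subrK.
rewrite (le_trans (ler_normB _ _)) // !mulrDl lerD //.
  rewrite (le_trans (ler_normD _ _)) // !normrZ !gtr0_norm //.
  by rewrite mulrAC lerD2l mulrC ler_pM2r.
by rewrite (le_trans yH) // ler_wpM2l // expr2 ler_piMr // ltW.
Qed.

Lemma theta1_sub_liminf {R : realType} {m n : nat}
    (b0 b1 : 'cV[R]_m) (A0 A1 : 'M[R]_(m, n)) :
  \rank A0 = m -> extended_slater1 b0 b1 A0 A1 ->
  theta1 b0 b1 A0 A1 `<=` set_liminf (theta b0 b1 A0 A1).
Proof.
move=> rk sl x0 tx0.
have [L [d [d_gt0 near_x0]]] := slater_restoration _ _ _ _ _ rk sl tx0.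
pose S e := [set x | theta b0 b1 A0 A1 e x /\ `|x - x0| <= L * e].
have Sxe e : 0 < e <= d -> S e (xget 0 (S e)).
  by move=> /near_x0[x tx xL]; apply: (xgetPex 0); exists x.
have near_d : \forall e \near (0 : R)^'+, 0 < e <= d.
  near=> e; apply/andP; split; near: e;
    [exact: nbhs_right_gt|exact: nbhs_right_le].
exists (fun e => xget 0 (S e)); split.
  by apply: filterS near_d => e /Sxe[].
have Le0 : L * e @[e --> (0 : R)^'+] --> (0 : R).
  rewrite -[X in _ --> X](mulr0 L); apply: cvgMr.
  by apply: (cvg_at_right_filter (f := id)); exact: cvg_id.
apply/cvgrPdistC_le => r r_gt0.
have Ler : \forall e \near (0 : R)^'+, L * e <= r by apply: (cvgr_le _ Le0).
by apply: filterS2 near_d Ler => e /Sxe[_ xL]; apply: le_trans.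
Unshelve. all: by end_near. Qed.

(** * Limits of the optimal values and of the optimal solutions *)

Lemma cvge_of_bounds {R : realType} {T : Type} {F : set_system T}
    {FF : Filter F} (f : T -> \bar R) (l : \bar R) :
  (forall r : R, (l < r%:E)%E -> \forall t \near F, (f t < r%:E)%E) ->
  (forall r : R, (r%:E < l)%E -> \forall t \near F, (r%:E < f t)%E) ->
  f @ F --> l.
Proof.
case: l => [l||] ltf gtf.
- move=> A [e /= e_gt0 Ae].
  have := ltf (l + e); rewrite lte_fin ltrDl => /(_ e_gt0).
  have := gtf (l - e); rewrite lte_fin ltrBlDr ltrDl => /(_ e_gt0).
  apply: filterS2 => t /=; case: (f t) => [r||] //; rewrite !lte_fin => lr rl.
  by apply: (Ae r); rewrite /ball /= ltr_distlC lr.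
- by apply/cvgeyPgt => r; apply: gtf; rewrite ltry.
- by apply/cvgeNyPlt => r; apply: ltf; rewrite ltNyr.
Qed.

Lemma limf_esup_le_of_bounds {R : realType} (F : set_system R)
    (f : R -> \bar R) (l : \bar R) :
  (forall r : R, (l < r%:E)%E -> \forall t \near F, (f t < r%:E)%E) ->
  (limf_esup f F <= l)%E.
Proof.
move=> ltf.
have le_r (r : R) : (l < r%:E)%E -> (limf_esup f F <= r%:E)%E.
  move=> /ltf Fr; rewrite limf_esupE.
  apply: (@le_trans _ _ (ereal_sup (f @` [set t | (f t < r%:E)%E]))).
    by apply: ereal_inf_lbound; exists [set t | (f t < r%:E)%E].
  by apply: ge_ereal_sup => _ [t /= /ltW ftr <-].
case: l {ltf} le_r => [l||] le_r; last 2 first.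
- exact: leey.
- by rewrite leeNy_eq; apply/eqP/eq_ninfty => r; apply: le_r; rewrite ltNyr.
- by apply/lee_addgt0Pr => e e_gt0; apply: le_r; rewrite lte_fin ltrDl.
Qed.

(** Feasible points converging to [y] bound the optimal values from below by
    quantities converging to [dot c0 y]. *)
Lemma F_star_near_gt {R : realType} {m n : nat}
    (c0 c1 : 'cV[R]_n) (b0 b1 : 'cV[R]_m) (A0 A1 : 'M[R]_(m, n)) y (r : R) :
  set_liminf (theta b0 b1 A0 A1) y -> r < dot c0 y ->
  \forall e \near (0 : R)^'+, (r%:E < F_star c0 c1 b0 b1 A0 A1 e)%E.
Proof.
move=> [ye [tye yey]] ry.
have lim : dot (c0 + e *: c1) (ye e) @[e --> (0 : R)^'+] --> dot c0 y.
  apply: cvg_dot => //; apply: (cvg_affine id).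
  by apply: (cvg_at_right_filter (f := id)); exact: cvg_id.
apply: filterS2 tye (cvgr_gt _ lim _ ry) => e tye re.
rewrite (@lt_le_trans _ _ (dot (c0 + e *: c1) (ye e))%:E) ?lte_fin //.
by apply: ereal_sup_ubound; exists (ye e).
Qed.

Lemma limsup_sub_theta1 {R : realType} {m n : nat}
    (c0 c1 : 'cV[R]_n) (b0 b1 : 'cV[R]_m) (A0 A1 : 'M[R]_(m, n)) :
  set_limsup (theta_star c0 c1 b0 b1 A0 A1) `<=` theta1 b0 b1 A0 A1.
Proof.
move=> x [eps [xs [eps_gt0 eps0 xs_opt xsx]]].
apply: (limit_theta1 _ _ _ _ eps xs x _ eps0 _ xsx); apply: nearW => // k.
by case: (xs_opt k).
Qed.

(** Upper and lower set limits play asymmetric roles: the feasible points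
    converging to [y] exist for every small [e], hence can be compared with the
    optimal solutions along whichever sequence defines [x]. *)
Lemma limsup_sub_argmax {R : realType} {m n : nat}
    (c0 c1 : 'cV[R]_n) (S : R -> set 'cV[R]_n) (x y : 'cV[R]_n) :
  set_limsup (fun e => argmax_set (c0 + e *: c1) (S e)) x ->
  set_liminf S y -> dot c0 y <= dot c0 x.
Proof.
move=> [eps [xs [eps_gt0 eps0 xs_opt xsx]]] [ye [Sye yey]].
have epsR : eps @ \oo --> (0 : R)^'+.
  move=> P P0; have : \forall k \near \oo, 0 < eps k -> P (eps k) := eps0 _ P0.
  by apply: filterS => k; apply.
have cvg_c : c0 + eps k *: c1 @[k --> \oo] --> c0 by exact: cvg_affine.
have lim_y : dot (c0 + eps k *: c1) (ye (eps k)) @[k --> \oo] --> dot c0 y.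
  by apply: cvg_dot => //; apply: (cvg_comp eps ye epsR yey).
have lim_x : dot (c0 + eps k *: c1) (xs k) @[k --> \oo] --> dot c0 x.
  exact: cvg_dot.
have Sk : \forall k \near \oo, S (eps k) (ye (eps k)) := epsR _ Sye.
apply: (ler_cvg_to lim_y lim_x); apply: filterS Sk => k Sk.
by case: (xs_opt k) => _; apply.
Qed.

Theorem theorem1 (R : realType) (m n : nat)
    (c0 c1 : 'cV[R]_n) (b0 b1 : 'cV[R]_m) (A0 A1 : 'M[R]_(m, n))
    (gamma0 : R) (B : set 'cV[R]_n)
    (gamma0_gt0 : 0 < gamma0)
    (B_bounded : bounded_set B)
    (theta_star_B : forall e : R, 0 < e <= gamma0 ->
       theta_star c0 c1 b0 b1 A0 A1 e `<=` B)
    (rank_near : \forall e \near (0 : R)^'+, \rank (A0 + e *: A1)%R = m) :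
  [/\ set_limsup (theta_star c0 c1 b0 b1 A0 A1) `<=` theta1 b0 b1 A0 A1,
      eventually_bounded_above c0 c1 b0 b1 A0 A1 ->
        (limf_esup (F_star c0 c1 b0 b1 A0 A1) (0 : R)^'+
           <= F1_star c0 b0 b1 A0 A1)%E
    & \rank A0 = m -> extended_slater1 b0 b1 A0 A1 ->
      [/\ set_limsup (theta_star c0 c1 b0 b1 A0 A1)
            `<=` theta1_star c0 b0 b1 A0 A1,
          eventually_bounded_above c0 c1 b0 b1 A0 A1 ->
            F_star c0 c1 b0 b1 A0 A1 e @[e --> (0 : R)^'+]
              --> F1_star c0 b0 b1 A0 A1
        & forall x0 : 'cV[R]_n, theta1_star c0 b0 b1 A0 A1 x0 ->
            set_liminf (theta b0 b1 A0 A1) x0 /\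
            (eventually_bounded_above c0 c1 b0 b1 A0 A1 ->
              F_star c0 c1 b0 b1 A0 A1 e @[e --> (0 : R)^'+]
                --> (dot c0 x0)%:E)]].
Proof.
have F_lt := F_star_near_lt _ _ _ _ _ _ _ _ _ gamma0_gt0 B_bounded theta_star_B.
split; first exact: limsup_sub_theta1.
  by move=> bdd; apply: limf_esup_le_of_bounds => r; exact: F_lt.
move=> rkA0 slater; have liminf := theta1_sub_liminf _ _ _ _ rkA0 slater.
have F_cvg : eventually_bounded_above c0 c1 b0 b1 A0 A1 ->
    F_star c0 c1 b0 b1 A0 A1 e @[e --> (0 : R)^'+] --> F1_star c0 b0 b1 A0 A1.
  move=> bdd; apply: cvge_of_bounds => r; first exact: F_lt.
  move=> /ereal_sup_gt[_ [y ty <-]]; rewrite lte_fin.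
  exact: F_star_near_gt (liminf _ ty).
split=> // [x x_lim|x0 [tx0 x0_opt]].
  split=> [|y /liminf]; first exact: limsup_sub_theta1 x_lim.
  exact: limsup_sub_argmax x_lim.
split=> [|bdd]; first exact: liminf.
suff <- : F1_star c0 b0 b1 A0 A1 = (dot c0 x0)%:E by exact: F_cvg.
apply/eqP; rewrite eq_le; apply/andP; split.
  by apply: ge_ereal_sup => _ [y ty <-]; rewrite lee_fin x0_opt.
by apply: ereal_sup_ubound; exists x0.
Qed.
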